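(* If $\pi$ is a permutation which contains the pattern $231$ but contains no copy of the Fishburn pattern $f$, then $\pi$ contains the pattern $3142$.
   Context: Permutations of $\{1,\dots,n\}$ are written in one-line notation $\pi=\pi_1\cdots\pi_n$. A permutation $\pi$ contains a (classical) pattern $\sigma$ if some subsequence of $\pi$ has the same length and relative order as $\sigma$; otherwise $\pi$ avoids $\sigma$. A copy of the Fishburn pattern $f$ in $\pi$ is a subsequence $\pi_j,\pi_{j+1},\pi_k$ with $j+1<k$, $\pi_j=\pi_k+1$, and $\pi_{j+1}>\pi_j$. *)

(* Defs.v *)
From mathcomp Require Import all_boot all_fingroup.

Set Implicit Arguments.
Unset Strict Implicit.
Unset Printing Implicit Defensive.

(* A permutation of {1, ..., n} is a p : 'S_n, with positions and values both
   shifted down by one; only comparisons of positions, comparisons of values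
   and differences of values occur below, so the shift is harmless.  Patterns
   are one-line words in the usual 1-based notation. *)

Definition contains (n k : nat) (p : 'S_n) (sigma : k.-tuple nat) : Prop :=
  exists f : 'I_k -> 'I_n,
    {homo f : i j / i < j} /\
    forall i j : 'I_k, (p (f i) < p (f j)) = (tnth sigma i < tnth sigma j).

(* (j, j', k) are the positions of a copy of f, with j' the position j + 1. *)
Definition fishburn_copy (n : nat) (p : 'S_n) (j j' k : 'I_n) : Prop :=
  [/\ j' = j.+1 :> nat, j' < k, p j = (p k).+1 :> nat & p j < p j'].

Definition contains_fishburn (n : nat) (p : 'S_n) : Prop :=
  exists j j' k : 'I_n, fishburn_copy p j j' k.

(* Main.v *)
(** Among the copies of 231 at positions a < b < c, descend on the value gap
    p a - p c. Let j be the last position in [a, b) with p j <= p a, so that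
    p (j+1) > p a. If p j < p c, then a, j, j+1, c is a copy of 3142. Otherwise
    j, j+1, c is a copy of 231; if p j = p c + 1 it is a Fishburn copy, and if
    not, the position d of the value p c + 1 lies either before j or after j+1,
    and the 231 copy d, j+1, c or j, j+1, d respectively has a smaller gap. *)
Require Import Defs.
From mathcomp Require Import all_boot all_fingroup.
From mathcomp Require Import zify.

Lemma contains3142 (n : nat) (p : 'S_n) (a b c d : 'I_n) :
  a < b < c -> c < d -> p b < p d < p a -> p a < p c ->
  contains p [tuple 3; 1; 4; 2].
Proof.
move=> abc cd bda ac; exists (tnth [tuple a; b; c; d]); split.
  by move=> [[|[|[|[|?]]]] ?] [[|[|[|[|?]]]] ?] //=; rewrite !(tnth_nth a) /=; lia.
by move=> [[|[|[|[|?]]]] ?] [[|[|[|[|?]]]] ?] //=;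
  rewrite !(tnth_nth a) !(tnth_nth 0) /=; lia.
Qed.

Lemma contains3142_of_231 (n : nat) (p : 'S_n) (a b c : 'I_n) :
  ~ contains_fishburn p ->
  a < b < c -> p c < p a < p b ->
  contains p [tuple 3; 1; 4; 2].
Proof.
move=> nofish.
have [m] := ubnP (p a - p c); elim: m a b c => // m IHm a b c gap abc cab.
pose low := [pred j : 'I_n | (j < b) && (p j <= p a)].
have Pa : low a by rewrite /= leqnn; lia.
case: (@arg_maxnP _ a low (fun j : 'I_n => j : nat) Pa) => j /andP[jb pja] jmax.
have aj := jmax a Pa.
have j1n : j.+1 < n by have := ltn_ord b; lia.
pose j' := Ordinal j1n.
have pj' : p a < p j'.
  (* If [j' < b], then [p j' <= p a] would contradict the maximality of [j]. *)
  have [eqb|neb] := eqVneq (j' : nat) b; first by rewrite (val_inj eqb); lia.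
  rewrite ltnNge; apply/negP => pj'a.
  have /jmax /= : (j' < b) && (p j' <= p a) by move: neb => /=; lia.
  lia.
have [jc|cj|/val_inj/perm_inj eqjc] := ltngtP (p j) (p c).
- have neaj : (a : nat) != j.
    by apply/eqP => /val_inj eqaj; move: jc; rewrite -eqaj; lia.
  by apply: (@contains3142 n p a j j' c) => //=; lia.
(* Since [p c < p j], the value [p c + 1] is in range and so is attained. *)
- have vn : (p c).+1 < n by have := ltn_ord (p j); lia.
  have [pj|nepj] := eqVneq (p j : nat) (p c).+1.
    by case: nofish; exists j, j', c; split => //=; lia.
  pose d := (p^-1)%g (Ordinal vn).
  have pd : p d = (p c).+1 :> nat by rewrite permKV.
  have nedj : (d : nat) != j.
    by apply/eqP => /val_inj eqd; move: nepj; rewrite -eqd pd eqxx.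
  have nedj' : (d : nat) != j'.
    by apply/eqP => /val_inj eqd; move: pj'; rewrite -eqd pd; lia.
  move: nedj' => /= nedj'.
  have [dj|jd] := ltnP d j.
    (* The new gap is 1, while [p a - p c >= p j - p c >= 2]. *)
    by apply: (IHm d j' c) => /=; lia.
  (* Here [p c < p d < p j <= p a], so the gap [p j - p d] is smaller. *)
  by apply: (IHm j j' d) => /=; lia.
(* [j = c] is impossible, as [j < b < c]. *)
- by move: jb; rewrite eqjc; lia.
Qed.

Theorem lemma2p1 (n : nat) (p : 'S_n) :
  contains p [tuple 2; 3; 1] ->
  ~ contains_fishburn p ->
  contains p [tuple 3; 1; 4; 2].
Proof.
move=> [f [f_incr f_ord]] nofish.
pose i0 : 'I_3 := @Ordinal 3 0 isT.
pose i1 : 'I_3 := @Ordinal 3 1 isT.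
pose i2 : 'I_3 := @Ordinal 3 2 isT.
apply: (@contains3142_of_231 n p (f i0) (f i1) (f i2)) => //.
  by rewrite !f_incr.
by rewrite !f_ord.
Qed.
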